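(* Let $\omega,g\in\mathbb{R}$ be constants and let the vertical density stratification $\rho_0=\rho_0(z)>0$ be given. If $\psi_0:\mathbb{S}^2\to\mathbb{R}$, $\psi_0=\psi_0(\varphi,\theta)$, solves $$\Delta\psi_0=F(\psi_0)$$ for some $F\in C^1(\mathbb{R},\mathbb{R})$, then $$\psi(\varphi,\theta,z,t)=\omega\sin\theta+\frac{1}{\sqrt{\rho_0(z)}}\,\psi_0(\varphi+\omega t,\theta),$$ with the associated pressure $$p_0(\varphi,\theta,z,t)=\mathcal{F}\big(\psi_0(\varphi+\omega t,\theta)\big)-\frac12\Big(\frac{\partial\psi_0}{\partial\theta}(\varphi+\omega t,\theta)\Big)^2-\frac{1}{2\cos^2\theta}\Big(\frac{\partial\psi_0}{\partial\varphi}(\varphi+\omega t,\theta)\Big)^2-g\int_0^z\rho_0(s)\,{\rm d}s ,$$ where $\mathcal{F}$ is a primitive of $F$, is a solution of the system $$\begin{aligned} &\frac{\partial u_0}{\partial t}+\frac{u_0}{\cos\theta}\frac{\partial u_0}{\partial\varphi}+v_0\frac{\partial u_0}{\partial\theta}-u_0v_0\tan\theta-2\omega v_0\sin\theta=-\frac{1}{\rho_0\cos\theta}\frac{\partial p_0}{\partial\varphi},\\ &\frac{\partial v_0}{\partial t}+\frac{u_0}{\cos\theta}\frac{\partial v_0}{\partial\varphi}+v_0\frac{\partial v_0}{\partial\theta}+u_0^2\tan\theta+2\omega u_0\sin\theta+\omega^2\sin\theta\cos\theta=-\frac{1}{\rho_0}\frac{\partial p_0}{\partial\theta},\\ &0=\frac{1}{\rho_0}\frac{\partial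 p_0}{\partial z}+g,\\ &\frac{\partial u_0}{\partial\varphi}+\frac{\partial}{\partial\theta}(v_0\cos\theta)=0, \end{aligned}$$ with $$u_0=-\frac{\partial\psi}{\partial\theta},\qquad v_0=\frac{1}{\cos\theta}\frac{\partial\psi}{\partial\varphi}.$$ (These solutions describe height-dependent stratospheric planetary flows that propagate zonally westwards.)
   Context: $\varphi\in[0,2\pi)$ is the longitude and $\theta\in(-\frac{\pi}{2},\frac{\pi}{2})$ the latitude on the unit sphere $\mathbb{S}^2$, $z$ is the nondimensional height variable, and $t$ is time. $\Delta=\partial_\theta^2-\tan\theta\,\partial_\theta+\frac{1}{\cos^2\theta}\partial_\varphi^2$ is the Laplace-Beltrami operator on $\mathbb{S}^2$. The system is the nondimensional leading-order system for stratospheric flow: $\omega$ is the inverse Rossby number, $g$ the nondimensional gravity, $(u_0,v_0)$ the horizontal (eastward, northward) velocity, and $p_0$ the pressure.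
   Formalization: The density ρ₀ is additionally assumed continuous (on all real z), since for discontinuous ρ₀ the pressure need not be differentiable in z; ψ₀ is taken to be a classical C² solution; the closing remark on westward propagation is not stated. *)

(* Defs.v *)
(* Stdlib reals with Coquelicot. *)
From Stdlib Require Import Reals Lra.
From Coquelicot Require Import Coquelicot.
Open Scope R_scope.

(** * The unit sphere in geographic coordinates *)

Record S2 : Type := mkS2 {
  S2_x : R; S2_y : R; S2_z : R;
  S2_unit : S2_x ^ 2 + S2_y ^ 2 + S2_z ^ 2 = 1
}.

Lemma lonlat_unit (phi theta : R) :
  (cos theta * cos phi) ^ 2 + (cos theta * sin phi) ^ 2 + sin theta ^ 2 = 1.
Proof.
pose proof (sin2_cos2 phi) as H1. pose proof (sin2_cos2 theta) as H2.
unfold Rsqr in H1, H2.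
replace (_ + _) with
  (cos theta * cos theta * (sin phi * sin phi + cos phi * cos phi)
   + sin theta * sin theta) by ring.
rewrite H1; lra.
Qed.

Lemma lonlat_rot_unit (phi theta : R) :
  sin theta ^ 2 + (cos theta * cos phi) ^ 2 + (cos theta * sin phi) ^ 2 = 1.
Proof. pose proof (lonlat_unit phi theta); lra. Qed.

(* The longitude [phi] is an arbitrary real; the point is 2*PI-periodic in it,
   so [phi + omega * t] needs no reduction modulo 2*PI. *)
Definition lonlat (phi theta : R) : S2 :=
  mkS2 _ _ _ (lonlat_unit phi theta).

(* The same chart with its poles on the x-axis. *)
Definition lonlat_rot (phi theta : R) : S2 :=
  mkS2 _ _ _ (lonlat_rot_unit phi theta).

Definition latitude (theta : R) : Prop := - (PI / 2) < theta < PI / 2.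

(* On R x (-PI/2, PI/2), [lonlat] and [lonlat_rot] are local diffeomorphisms
   onto the sphere minus their respective poles, and these two open sets cover
   the sphere: this is twice continuous differentiability on the whole sphere,
   poles included. *)
Definition C2_sphere (f : S2 -> R) : Prop :=
  forall phi theta : R, latitude theta ->
    ex_diff_n (fun a b => f (lonlat a b)) 2 phi theta /\
    ex_diff_n (fun a b => f (lonlat_rot a b)) 2 phi theta.

Definition Laplace_Beltrami (f : S2 -> R) (phi theta : R) : R :=
  Derive_n (fun b => f (lonlat phi b)) 2 theta
  - tan theta * Derive (fun b => f (lonlat phi b)) theta
  + / (cos theta) ^ 2 * Derive_n (fun a => f (lonlat a theta)) 2 phi.

(* The coordinate formula is singular at the poles. For f in C^2 of the sphere
   the equation off the poles is equivalent, by continuity, to the equation on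
   the whole sphere. *)
Definition solves_semilinear (F : R -> R) (f : S2 -> R) : Prop :=
  forall phi theta : R, latitude theta ->
    Laplace_Beltrami f phi theta = F (f (lonlat phi theta)).

Definition C1_function (F : R -> R) : Prop :=
  forall x : R, ex_derive F x /\ continuous (Derive F) x.

Definition is_primitive (G F : R -> R) : Prop :=
  forall x : R, is_derive G x (F x).

(** * Time-dependent fields, with arguments phi, theta, z, t *)

Definition field : Type := R -> R -> R -> R -> R.

Definition d_phi (h : field) : field :=
  fun phi theta z t => Derive (fun x => h x theta z t) phi.
Definition d_theta (h : field) : field :=
  fun phi theta z t => Derive (fun x => h phi x z t) theta.
Definition d_z (h : field) : field :=
  fun phi theta z t => Derive (fun x => h phi theta x t) z.
Definition d_t (h : field) : field :=
  fun phi theta z t => Derive (fun x => h phi theta z x) t.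

Definition ex_d_phi (h : field) (phi theta z t : R) : Prop :=
  ex_derive (fun x => h x theta z t) phi.
Definition ex_d_theta (h : field) (phi theta z t : R) : Prop :=
  ex_derive (fun x => h phi x z t) theta.
Definition ex_d_z (h : field) (phi theta z t : R) : Prop :=
  ex_derive (fun x => h phi theta x t) z.
Definition ex_d_t (h : field) (phi theta z t : R) : Prop :=
  ex_derive (fun x => h phi theta z x) t.

(* [Derive] is total, so the existence of every partial derivative occurring
   in the system is required separately. *)
Definition fields_differentiable (u v p : field) (phi theta z t : R) : Prop :=
  (ex_d_t u phi theta z t /\ ex_d_phi u phi theta z t
     /\ ex_d_theta u phi theta z t) /\
  (ex_d_t v phi theta z t /\ ex_d_phi v phi theta z t
     /\ ex_d_theta v phi theta z t) /\
  (ex_d_phi p phi theta z t /\ ex_d_theta p phi theta z t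
     /\ ex_d_z p phi theta z t).

Definition zonal_momentum (omega : R) (rho : R -> R) (u v p : field)
    (phi theta z t : R) : Prop :=
  d_t u phi theta z t
  + u phi theta z t / cos theta * d_phi u phi theta z t
  + v phi theta z t * d_theta u phi theta z t
  - u phi theta z t * v phi theta z t * tan theta
  - 2 * omega * v phi theta z t * sin theta
  = - (1 / (rho z * cos theta)) * d_phi p phi theta z t.

Definition meridional_momentum (omega : R) (rho : R -> R) (u v p : field)
    (phi theta z t : R) : Prop :=
  d_t v phi theta z t
  + u phi theta z t / cos theta * d_phi v phi theta z t
  + v phi theta z t * d_theta v phi theta z t
  + (u phi theta z t) ^ 2 * tan theta
  + 2 * omega * u phi theta z t * sin theta
  + omega ^ 2 * sin theta * cos theta
  = - (1 / rho z) * d_theta p phi theta z t.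

Definition hydrostatic_balance (g : R) (rho : R -> R) (p : field)
    (phi theta z t : R) : Prop :=
  0 = 1 / rho z * d_z p phi theta z t + g.

Definition incompressibility (u v : field) (phi theta z t : R) : Prop :=
  d_phi u phi theta z t
  + d_theta (fun a b c d => v a b c d * cos b) phi theta z t = 0.

Definition solves_system (omega g : R) (rho : R -> R) (u v p : field) : Prop :=
  forall phi theta z t : R, latitude theta ->
    fields_differentiable u v p phi theta z t /\
    zonal_momentum omega rho u v p phi theta z t /\
    meridional_momentum omega rho u v p phi theta z t /\
    hydrostatic_balance g rho p phi theta z t /\
    incompressibility u v phi theta z t.

Definition eastward_velocity (psi : field) : field :=
  fun phi theta z t => - d_theta psi phi theta z t.

Definition northward_velocity (psi : field) : field :=
  fun phi theta z t => 1 / cos theta * d_phi psi phi theta z t.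

Definition stream_solution (omega g : R) (rho : R -> R) (psi p : field) : Prop :=
  (forall phi theta z t : R, latitude theta ->
     ex_d_phi psi phi theta z t /\ ex_d_theta psi phi theta z t) /\
  solves_system omega g rho (eastward_velocity psi) (northward_velocity psi) p.

(* Main.v *)
(* Off the moving frame [a = phi + omega t], the velocity is the rigid rotation
   [- omega cos theta] plus a stationary flow with stream function
   [psi0 / sqrt rho0].  The frame speed and the Coriolis and centrifugal terms
   cancel, and what remains is [1 / rho0] times the stationary Euler equation on
   the sphere for [psi0], whose pressure is the Bernoulli expression given. *)
Require Import Defs.
From Stdlib Require Import Reals Lra.
From Coquelicot Require Import Coquelicot.
Open Scope R_scope.

(** * Calculus on the open strip of latitudes *)

Definition d_lon (f : R -> R -> R) (a b : R) : R := Derive (fun x => f x b) a.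
Definition d_lat (f : R -> R -> R) (a b : R) : R := Derive (fun x => f a x) b.

Definition C2_strip (f : R -> R -> R) : Prop :=
  forall a b : R, latitude b -> ex_diff_n f 2 a b.

Lemma latitude_locally (b : R) : latitude b -> locally b latitude.
Proof.
intros Hb.
apply (open_and (fun x => - (PI / 2) < x) (fun x => x < PI / 2)); auto.
- apply open_gt.
- apply open_lt.
Qed.

Lemma cos_latitude_neq0 (b : R) : latitude b -> cos b <> 0.
Proof. intros [H1 H2]; pose proof (cos_gt_0 b H1 H2); lra. Qed.

(** The velocity formulas below are available only on the strip; since it is open, they may still be
    differentiated in the latitude. *)
Lemma is_derive_ext_latitude (h k : R -> R) (b l : R) :
  latitude b -> (forall x, latitude x -> h x = k x) ->
  is_derive h b l -> is_derive k b l.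
Proof.
intros Hb Hhk; apply is_derive_ext_loc.
now apply (filter_imp latitude); [ | apply latitude_locally ].
Qed.

Lemma C2_strip_derive (f : R -> R -> R) (a b : R) : C2_strip f -> latitude b ->
  (is_derive (fun x : R => f x b) a (d_lon f a b) /\
   is_derive (fun x : R => f a x) b (d_lat f a b)) /\
  (is_derive (fun x : R => d_lon f x b) a (d_lon (d_lon f) a b) /\
   is_derive (fun x : R => d_lon f a x) b (d_lat (d_lon f) a b)) /\
  (is_derive (fun x : R => d_lat f x b) a (d_lon (d_lat f) a b) /\
   is_derive (fun x : R => d_lat f a x) b (d_lat (d_lat f) a b)).
Proof.
intros Hf Hb.
destruct (Hf a b Hb) as [_ [H1 [H2 [[_ [H3 [H4 _]]] [_ [H5 [H6 _]]]]]]].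
repeat apply conj; apply Derive_correct; assumption.
Qed.

Lemma C2_strip_schwarz (f : R -> R -> R) (a b : R) : C2_strip f -> latitude b ->
  d_lon (d_lat f) a b = d_lat (d_lon f) a b.
Proof.
intros Hf Hb.
apply Schwarz.
- destruct (latitude_locally b Hb) as [d Hd].
  exists d; intros x y _ Hy.
  destruct (Hf x y (Hd y Hy)) as [_ [H1 [H2 [[_ [_ [H4 _]]] [_ [H5 _]]]]]].
  auto.
(* Continuity of the mixed derivatives is the order-zero level of the nested [ex_diff_n]: first for
   [d_lon (d_lat f)], then for [d_lat (d_lon f)]. *)
- destruct (Hf a b Hb) as [_ [_ [_ [_ [_ [_ [_ [[H _] _]]]]]]]]; exact H.
- destruct (Hf a b Hb) as [_ [_ [_ [[_ [_ [_ [_ [H _]]]]] _]]]]; exact H.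
Qed.

(** * Chain rules for the moving frame *)

Lemma is_derive_translate (h : R -> R) (x k l : R) :
  is_derive h (x + k) l -> is_derive (fun y : R => h (y + k)) x l.
Proof.
intros H; replace l with (scal 1 l) by apply (scal_one l).
apply (is_derive_comp h (fun y => y + k)); [ exact H | ].
auto_derive; [ exact I | ring ].
Qed.

(** Time enters only through [a + omega * t], so a time derivative is [omega] times a longitude
    derivative; in the momentum equations it cancels the advection by the rigid rotation. *)
Lemma is_derive_travelling (h : R -> R) (a omega t l : R) :
  is_derive h (a + omega * t) l ->
  is_derive (fun y : R => h (a + omega * y)) t (omega * l).
Proof.
intros H; apply (is_derive_comp h (fun y => a + omega * y)); [ exact H | ].
auto_derive; [ exact I | ring ].
Qed.

Lemma is_derive_affine (h : R -> R) (x c s l : R) :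
  is_derive h x l -> is_derive (fun y : R => c + s * h y) x (s * l).
Proof.
intros H; auto_derive; [ now exists l | ].
(* The ascription restores the eta-expanded form left by [auto_derive]. *)
rewrite (is_derive_unique h _ _ H : Derive (fun x => h x) _ = _); ring.
Qed.

(** * The travelling stream function and its velocity *)

(** The profile [s] stands for [1 / sqrt rho0]: a constant for derivatives in longitude, latitude
    and time, tied to the density only at the end, through its square. *)
Definition travelling_stream (omega : R) (s : R -> R) (f : R -> R -> R) : field :=
  fun phi theta z t => omega * sin theta + s z * f (phi + omega * t) theta.

Lemma travelling_stream_d_phi (omega : R) (s : R -> R) (f : R -> R -> R)
    (phi theta z t : R) : C2_strip f -> latitude theta ->
  is_derive (fun x : R => travelling_stream omega s f x theta z t) phi
    (s z * d_lon f (phi + omega * t) theta).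
Proof.
intros Hf Hb.
apply (is_derive_affine (fun y => f (y + omega * t) theta)).
apply (is_derive_translate (fun a => f a theta)).
destruct (C2_strip_derive f (phi + omega * t) theta Hf Hb) as [[H _] _].
exact H.
Qed.

Lemma travelling_stream_d_theta (omega : R) (s : R -> R) (f : R -> R -> R)
    (phi theta z t : R) : C2_strip f -> latitude theta ->
  is_derive (fun x : R => travelling_stream omega s f phi x z t) theta
    (omega * cos theta + s z * d_lat f (phi + omega * t) theta).
Proof.
intros Hf Hb; unfold travelling_stream.
destruct (C2_strip_derive f (phi + omega * t) theta Hf Hb) as [[_ H] _].
(* With the shifted longitude frozen, [f] becomes an opaque function of latitude that [auto_derive]
   can handle. *)
revert H; generalize (d_lat f (phi + omega * t) theta).
generalize (f (phi + omega * t)); intros h l H.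
auto_derive; [ now exists l | ].
rewrite (is_derive_unique h _ _ H : Derive (fun x => h x) _ = _); ring.
Qed.

Lemma eastward_travelling (omega : R) (s : R -> R) (f : R -> R -> R)
    (phi theta z t : R) : C2_strip f -> latitude theta ->
  eastward_velocity (travelling_stream omega s f) phi theta z t
  = - omega * cos theta + - s z * d_lat f (phi + omega * t) theta.
Proof.
intros Hf Hb; unfold eastward_velocity, d_theta.
rewrite (is_derive_unique _ _ _
  (travelling_stream_d_theta omega s f phi theta z t Hf Hb)); ring.
Qed.

(** The rigid rotation has no northward part; the explicit [0] keeps the shape expected by
    [is_derive_affine]. *)
Lemma northward_travelling (omega : R) (s : R -> R) (f : R -> R -> R)
    (phi theta z t : R) : C2_strip f -> latitude theta ->
  northward_velocity (travelling_stream omega s f) phi theta z t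
  = 0 + s z / cos theta * d_lon f (phi + omega * t) theta.
Proof.
intros Hf Hb; unfold northward_velocity, d_phi.
rewrite (is_derive_unique _ _ _
  (travelling_stream_d_phi omega s f phi theta z t Hf Hb)); unfold Rdiv; ring.
Qed.

Lemma eastward_travelling_derive (omega : R) (s : R -> R) (f : R -> R -> R)
    (phi theta z t : R) : C2_strip f -> latitude theta ->
  let u := eastward_velocity (travelling_stream omega s f) in
  let a := phi + omega * t in
  is_derive (fun x : R => u phi theta z x) t
    (- s z * (omega * d_lon (d_lat f) a theta)) /\
  is_derive (fun x : R => u x theta z t) phi (- s z * d_lon (d_lat f) a theta) /\
  is_derive (fun x : R => u phi x z t) theta
    (omega * sin theta - s z * d_lat (d_lat f) a theta).
Proof.
intros Hf Hb u a; unfold u.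
destruct (C2_strip_derive f a theta Hf Hb) as [_ [_ [Ha Hth]]].
split; [ | split ].
- eapply is_derive_ext.
  { intros x; symmetry; now apply eastward_travelling. }
  apply (is_derive_affine (fun x => d_lat f (phi + omega * x) theta)).
  now apply (is_derive_travelling (fun y => d_lat f y theta)).
- eapply is_derive_ext.
  { intros x; symmetry; now apply eastward_travelling. }
  apply (is_derive_affine (fun x => d_lat f (x + omega * t) theta)).
  now apply (is_derive_translate (fun y => d_lat f y theta)).
- eapply (is_derive_ext_latitude _ _ _ _ Hb).
  { intros x Hx; symmetry; now apply eastward_travelling. }
  fold a; revert Hth; generalize (d_lat (d_lat f) a theta).
  generalize (d_lat f a); intros h l H.
  auto_derive; [ now exists l | ].
  rewrite (is_derive_unique h _ _ H : Derive (fun x => h x) _ = _); ring.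
Qed.

(** The term in [sin theta / cos theta ^ 2] comes from differentiating the factor
    [1 / cos theta]. *)
Lemma northward_travelling_derive (omega : R) (s : R -> R) (f : R -> R -> R)
    (phi theta z t : R) : C2_strip f -> latitude theta ->
  let v := northward_velocity (travelling_stream omega s f) in
  let a := phi + omega * t in
  is_derive (fun x : R => v phi theta z x) t
    (s z / cos theta * (omega * d_lon (d_lon f) a theta)) /\
  is_derive (fun x : R => v x theta z t) phi
    (s z / cos theta * d_lon (d_lon f) a theta) /\
  is_derive (fun x : R => v phi x z t) theta
    (s z / cos theta * d_lat (d_lon f) a theta
     + s z * sin theta / cos theta ^ 2 * d_lon f a theta).
Proof.
intros Hf Hb v a; unfold v.
destruct (C2_strip_derive f a theta Hf Hb) as [_ [[Ha Hth] _]].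
pose proof (cos_latitude_neq0 theta Hb) as Hc.
split; [ | split ].
- eapply is_derive_ext.
  { intros x; symmetry; now apply northward_travelling. }
  apply (is_derive_affine (fun x => d_lon f (phi + omega * x) theta)).
  now apply (is_derive_travelling (fun y => d_lon f y theta)).
- eapply is_derive_ext.
  { intros x; symmetry; now apply northward_travelling. }
  apply (is_derive_affine (fun x => d_lon f (x + omega * t) theta)).
  now apply (is_derive_translate (fun y => d_lon f y theta)).
- eapply (is_derive_ext_latitude _ _ _ _ Hb).
  { intros x Hx; symmetry; now apply northward_travelling. }
  fold a; revert Hth; generalize (d_lat (d_lon f) a theta).
  generalize (d_lon f a); intros h l H.
  auto_derive; [ split; [ exact Hc | split; [ now exists l | exact I ] ] | ].
  rewrite (is_derive_unique h _ _ H : Derive (fun x => h x) _ = _); field; exact Hc.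
Qed.

(** The weight [cos] removes the denominator of the velocity, so that incompressibility reduces to
    the symmetry of mixed derivatives. *)
Lemma northward_travelling_cos_derive (omega : R) (s : R -> R)
    (f : R -> R -> R) (phi theta z t : R) : C2_strip f -> latitude theta ->
  is_derive
    (fun x : R => northward_velocity (travelling_stream omega s f) phi x z t * cos x)
    theta (s z * d_lat (d_lon f) (phi + omega * t) theta).
Proof.
intros Hf Hb.
apply (is_derive_ext_latitude
  (fun x => 0 + s z * d_lon f (phi + omega * t) x) _ _ _ Hb).
{ intros x Hx; rewrite northward_travelling by assumption.
  field; now apply cos_latitude_neq0. }
apply (is_derive_affine (d_lon f (phi + omega * t))).
destruct (C2_strip_derive f (phi + omega * t) theta Hf Hb) as [_ [[_ H] _]].
exact H.
Qed.

(** * The Bernoulli pressure *)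

(** The two squares form half the squared spherical gradient of [f]. When [s ^ 2 = / rho] this is
    the kinetic energy density of the flow left after the rigid rotation, hence independent of
    height. *)
Definition travelling_pressure (omega g : R) (rho calF : R -> R)
    (f : R -> R -> R) : field :=
  fun phi theta z t =>
    calF (f (phi + omega * t) theta)
    - 1 / 2 * (d_lat f (phi + omega * t) theta) ^ 2
    - 1 / (2 * (cos theta) ^ 2) * (d_lon f (phi + omega * t) theta) ^ 2
    - g * RInt rho 0 z.

(** Chain rule in the horizontal variables, fundamental theorem of calculus in [z]. The term in
    [sin theta / cos theta ^ 3], from the factor [1 / cos theta ^ 2], matches the one in
    [v * d_theta v]. *)
Lemma travelling_pressure_derive (omega g : R) (rho F calF : R -> R)
    (f : R -> R -> R) (phi theta z t : R) :
  (forall y, continuous rho y) -> is_primitive calF F ->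
  C2_strip f -> latitude theta ->
  let p := travelling_pressure omega g rho calF f in
  let a := phi + omega * t in
  is_derive (fun x : R => p x theta z t) phi
    (F (f a theta) * d_lon f a theta
     - d_lat f a theta * d_lon (d_lat f) a theta
     - d_lon f a theta * d_lon (d_lon f) a theta / cos theta ^ 2) /\
  is_derive (fun x : R => p phi x z t) theta
    (F (f a theta) * d_lat f a theta
     - d_lat f a theta * d_lat (d_lat f) a theta
     - d_lon f a theta * d_lat (d_lon f) a theta / cos theta ^ 2
     - sin theta / cos theta ^ 3 * d_lon f a theta ^ 2) /\
  is_derive (fun x : R => p phi theta x t) z (- g * rho z).
Proof.
intros Hrho HF Hf Hb p a; unfold p, travelling_pressure.
destruct (C2_strip_derive f a theta Hf Hb)
  as [[Ha0 Hb0] [[Ha1 Hb1] [Ha2 Hb2]]].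
pose proof (cos_latitude_neq0 theta Hb) as Hc.
pose proof (HF (f a theta)) as HG.
split; [ | split ].
- apply (is_derive_translate (fun y => calF (f y theta)
    - 1 / 2 * d_lat f y theta ^ 2
    - 1 / (2 * cos theta ^ 2) * d_lon f y theta ^ 2 - g * RInt rho 0 z)).
  fold a; generalize (RInt rho 0 z); intros r.
  (* Opaque one-variable functions are prepared for [auto_derive]; that [h1] is the derivative of
     [h0] at [a] must be recorded before the bodies are cleared. *)
  set (h0 := fun y => f y theta) in *; set (h1 := fun y => d_lon f y theta) in *.
  set (h2 := fun y => d_lat f y theta) in *.
  change (is_derive (fun y : R => calF (h0 y) - 1 / 2 * h2 y ^ 2
    - 1 / (2 * cos theta ^ 2) * h1 y ^ 2 - g * r) a
    (F (h0 a) * h1 a - h2 a * d_lon (d_lat f) a theta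
     - h1 a * d_lon (d_lon f) a theta / cos theta ^ 2)).
  change (is_derive h0 a (h1 a)) in Ha0.
  change (is_derive calF (h0 a) (F (h0 a))) in HG.
  clearbody h0 h1 h2.
  auto_derive; [ repeat split; eexists; eassumption | ].
  change (fun x => calF x) with calF; change (fun x => h0 x) with h0.
  change (fun x => h1 x) with h1; change (fun x => h2 x) with h2.
  rewrite (is_derive_unique _ _ _ HG), (is_derive_unique _ _ _ Ha0),
    (is_derive_unique _ _ _ Ha1), (is_derive_unique _ _ _ Ha2).
  field; exact Hc.
- fold a; generalize (RInt rho 0 z); intros r.
  revert Hb0 Hb1 Hb2 HG.
  generalize (d_lat (d_lat f) a theta) (d_lat (d_lon f) a theta).
  set (h0 := f a); set (h1 := d_lon f a); set (h2 := d_lat f a).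
  clearbody h0 h1 h2; intros l2 l1 Hb0 Hb1 Hb2 HG.
  auto_derive; [ repeat split; try (eexists; eassumption) | ].
  (* The condition left is that [2 * cos theta ^ 2] does not vanish. *)
  { intros E; apply Hc; clear -E; nra. }
  change (fun x => calF x) with calF; change (fun x => h0 x) with h0.
  change (fun x => h1 x) with h1; change (fun x => h2 x) with h2.
  rewrite (is_derive_unique _ _ _ HG), (is_derive_unique _ _ _ Hb0),
    (is_derive_unique _ _ _ Hb1), (is_derive_unique _ _ _ Hb2).
  field; exact Hc.
- assert (Hi : is_derive (RInt rho 0) z (rho z)).
  { apply (is_derive_RInt rho (RInt rho 0) 0 z); [ | apply Hrho ].
    apply filter_forall; intros y.
    apply (RInt_correct (V := R_CompleteNormedModule)).
    apply (ex_RInt_continuous (V := R_CompleteNormedModule)).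
    intros; apply Hrho. }
  revert Hi; generalize (RInt rho 0); intros h Hi.
  (* The horizontal part of the pressure is the constant, and [- g] the slope. *)
  apply (is_derive_affine h _
    (calF (f (phi + omega * t) theta)
     - 1 / 2 * d_lat f (phi + omega * t) theta ^ 2
     - 1 / (2 * cos theta ^ 2) * d_lon f (phi + omega * t) theta ^ 2) (- g))
    in Hi.
  eapply is_derive_ext; [ | exact Hi ].
  intros y; simpl; ring.
Qed.

(** * Verification of the system *)

Lemma travelling_solution (omega g : R) (s rho F calF : R -> R)
    (f : R -> R -> R) :
  (forall z, rho z <> 0 /\ s z ^ 2 = / rho z) ->
  (forall z, continuous rho z) -> is_primitive calF F -> C2_strip f ->
  (forall a b, latitude b ->
     d_lat (d_lat f) a b - tan b * d_lat f a b
     + / cos b ^ 2 * d_lon (d_lon f) a b = F (f a b)) ->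
  stream_solution omega g rho (travelling_stream omega s f)
    (travelling_pressure omega g rho calF f).
Proof.
intros Hs Hrho HF Hf Heq; split.
{ intros phi theta z t Hb; split; eexists.
  - now apply travelling_stream_d_phi.
  - now apply travelling_stream_d_theta. }
intros phi theta z t Hb.
pose proof (cos_latitude_neq0 theta Hb) as Hc.
destruct (Hs z) as [Hr Hsz].
destruct (eastward_travelling_derive omega s f phi theta z t Hf Hb)
  as [Hut [Hua Huth]].
destruct (northward_travelling_derive omega s f phi theta z t Hf Hb)
  as [Hvt [Hva Hvth]].
destruct (travelling_pressure_derive omega g rho F calF f phi theta z t
  Hrho HF Hf Hb) as [Hpa [Hpth Hpz]].
pose proof (northward_travelling_cos_derive omega s f phi theta z t Hf Hb) as Hvc.
split; [ repeat split; eexists; eassumption | ].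
unfold zonal_momentum, meridional_momentum, hydrostatic_balance,
  incompressibility, d_phi, d_theta, d_z, d_t.
(* Read from right to left, [Heq] turns [F (f a theta)] into the Laplacian, so [F] disappears;
   Schwarz leaves a single mixed derivative. *)
rewrite (is_derive_unique _ _ _ Hut), (is_derive_unique _ _ _ Hua),
  (is_derive_unique _ _ _ Huth), (is_derive_unique _ _ _ Hvt),
  (is_derive_unique _ _ _ Hva), (is_derive_unique _ _ _ Hvth),
  (is_derive_unique _ _ _ Hpa), (is_derive_unique _ _ _ Hpth),
  (is_derive_unique _ _ _ Hpz), (is_derive_unique _ _ _ Hvc),
  eastward_travelling, northward_travelling, <- Heq, C2_strip_schwarz
  by assumption.
unfold tan.
(* The derivatives of [f] may be treated as independent unknowns: only rational identities remain,
   with no trigonometric relation beyond [tan] as a quotient. *)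
generalize (d_lat (d_lat f) (phi + omega * t) theta),
  (d_lat (d_lon f) (phi + omega * t) theta),
  (d_lon (d_lon f) (phi + omega * t) theta),
  (d_lat f (phi + omega * t) theta), (d_lon f (phi + omega * t) theta).
intros fbb fab faa fb fa.
(* Here the choice of [s] enters: the quadratic advection terms carry [s z ^ 2], and so must the
   pressure gradient. *)
replace (1 / (rho z * cos theta)) with (s z ^ 2 / cos theta)
  by (rewrite Hsz; field; auto).
replace (- (1 / rho z)) with (- s z ^ 2) by (rewrite Hsz; field; auto).
repeat apply conj; field; auto.
Qed.

Theorem theorem11 (omega g : R) (rho0 : R -> R) (F calF : R -> R) (psi0 : S2 -> R)
  (rho0_pos : forall z : R, 0 < rho0 z)
  (rho0_cont : forall z : R, continuous rho0 z)
  (F_C1 : C1_function F)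
  (calF_primitive : is_primitive calF F)
  (psi0_C2 : C2_sphere psi0)
  (psi0_eq : solves_semilinear F psi0) :
  stream_solution omega g rho0
    (fun phi theta z t =>
       omega * sin theta
       + 1 / sqrt (rho0 z) * psi0 (lonlat (phi + omega * t) theta))
    (fun phi theta z t =>
       calF (psi0 (lonlat (phi + omega * t) theta))
       - 1 / 2 * (Derive (fun b => psi0 (lonlat (phi + omega * t) b)) theta) ^ 2
       - 1 / (2 * (cos theta) ^ 2)
         * (Derive (fun a => psi0 (lonlat a theta)) (phi + omega * t)) ^ 2
       - g * RInt rho0 0 z).
Proof.
(* In the chart [lonlat], the displayed derivatives are [d_lon] and [d_lat] up to conversion, and
   [solves_semilinear] unfolds to the coordinate equation. *)
apply (travelling_solution omega g (fun z => 1 / sqrt (rho0 z)) rho0 F calF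
  (fun a b => psi0 (lonlat a b))); try assumption.
- intros z; pose proof (rho0_pos z) as Hz; split; [ lra | ].
  (* Only the [rho0 z] on the right is rewritten as a squared root. *)
  rewrite <- (pow2_sqrt (rho0 z)) at 2 by lra.
  pose proof (sqrt_lt_R0 _ Hz); field; lra.
- intros a b Hb; now apply psi0_C2.
Qed.
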